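(* Let $Q$ be a quantale and let $\Sigma_Q$ be the set of all finitely generated proper ideals of $Q$. If the quantale space $\Sigma_Q$ is quasi-compact, then $\mathrm{Max}_Q\subseteq\Sigma_Q$.
   Context: A quantale here means a complete lattice $(Q,\preccurlyeq,\bot,\top)$ with a binary operation $\&$ that is associative, commutative, satisfies $x\&\bigl(\bigvee_{\lambda} y_\lambda\bigr)=\bigvee_\lambda (x\& y_\lambda)$ for all families, and satisfies $x\&\top=x$ for all $x$. An ideal of $Q$ is a nonempty subset $I\subseteq Q$ such that $x,y\in I$ implies $x\vee y\in I$, and $x\in I$, $l\preccurlyeq x$ imply $l\in I$. $\mathcal I_Q$ is the set of all ideals of $Q$. An ideal is proper if $I\neq Q$; $\mathrm{Max}_Q$ is the set of maximal ideals (proper ideals not properly contained in any other proper ideal). For nonempty $S\subseteq Q$, the ideal generated by $S$ is $\langle S\rangle=\{x\in Q\mid x\preccurlyeq\bigvee_{i=1}^n a_i \text{ for some } n\in\mathbb N,\ a_i\in Q\& S\}$, where $Q\& S=\{q\& s\mid q\in Q,\ s\in S\}$; an ideal is finitely generated if it equals $\langle S\rangle$ for some finite nonempty $S$. For a set $\Sigma_Q$ of proper ideals of $Q$ and $X\subseteq \mathcal I_Q$, put $X^{\uparrow}=\{J\in\Sigma_Q\mid \bigcap X\subseteq J\}$ if $X\neq\emptyset$ and $\emptyset^{\uparrow}=\emptyset$. The quantale topology on $\Sigma_Q$ is the topology having the sets $X^{\uparrow}$ ($X\subseteq \mathcal I_Q$) as a subbasis of closed sets; $\Sigma_Q$ with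 this topology is called a quantale space. A space is quasi-compact if every open cover has a finite subcover (no Hausdorff assumption). *)

(* Defs.v *)
From HB Require Import structures.
From mathcomp Require Import all_boot all_order.
From mathcomp Require Import all_classical topology.

Set Implicit Arguments.
Unset Strict Implicit.
Unset Printing Implicit Defensive.

Import Order.TTheory.

Local Open Scope classical_set_scope.

HB.mixin Record isCompleteLattice d T of Order.TBLattice d T := {
  lub : set T -> T;
  lubP : forall S : set T, isLub S (lub S)
}.

#[short(type="completeLatticeType")]
HB.structure Definition CompleteLattice d :=
  { T of isCompleteLattice d T & Order.TBLattice d T }.

(* The distributivity axiom includes S = set0, i.e. qmul x \bot = \bot. *)
HB.mixin Record isQuantale d T of CompleteLattice d T := {
  qmul : T -> T -> T;
  qmulA : associative qmul;
  qmulC : commutative qmul;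
  qmul_lub : forall (x : T) (S : set T), qmul x (lub S) = lub (qmul x @` S);
  qmulx1 : forall x : T, qmul x \top%O = x
}.

#[short(type="quantaleType")]
HB.structure Definition Quantale d :=
  { T of isQuantale d T & CompleteLattice d T }.

Section Ideals.
Context {d : Order.disp_t} {Q : quantaleType d}.
Implicit Types (I J S : set Q) (Sigma : set (set Q)) (X : set (set Q)).

Definition is_ideal I : Prop :=
  [/\ I !=set0,
      forall x y, I x -> I y -> I (x `|` y)%O
    & forall x l, I x -> (l <= x)%O -> I l].

Definition is_proper_ideal I : Prop := is_ideal I /\ I <> setT.

Definition is_maximal_ideal I : Prop :=
  is_proper_ideal I /\ forall J, is_proper_ideal J -> ~ I `<` J.

(* n = 0 is allowed; the empty join is \bot, which belongs to the ideal
   generated by S anyway as soon as S is nonempty. *)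
Definition gen_ideal S : set Q :=
  [set x | exists (n : nat) (a : 'I_n -> Q),
    (forall i, [set qmul q s | q in setT & s in S] (a i)) /\
    (x <= \join_(i < n) a i)%O].

Definition finitely_generated I : Prop :=
  exists S, [/\ finite_set S, S !=set0 & I = gen_ideal S].

Definition quantale_space Sigma : Type := set_type Sigma.

HB.instance Definition _ Sigma :=
  Choice.copy (quantale_space Sigma) (set_type Sigma).

(* The conjunct X !=set0 encodes the convention that the empty family has an
   empty up-set (its intersection would otherwise be the whole of Q). *)
Definition upset Sigma X : set (quantale_space Sigma) :=
  [set J | X !=set0 /\ \bigcap_(I in X) I `<=` set_val J].

HB.instance Definition _ Sigma :=
  isSubBaseTopological.Build (quantale_space Sigma)
    [set X : set (set Q) | X `<=` is_ideal]
    (fun X => ~` @upset Sigma X).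

End Ideals.
Arguments upset {d Q} Sigma X _.

Definition max_ideals d (Q : quantaleType d) : set (set Q) :=
  [set I | is_maximal_ideal I].
Arguments max_ideals {d} Q.

Definition fg_proper_ideals d (Q : quantaleType d) : set (set Q) :=
  [set I | is_proper_ideal I /\ finitely_generated I].
Arguments fg_proper_ideals {d} Q.

(* Main.v *)
Require Import Defs.
From mathcomp Require Import all_boot all_order finmap.
From mathcomp Require Import all_classical topology.

(** If M is a maximal ideal, the closed sets {J | x \in J}, for x \in M, have
    the finite intersection property: the principal ideal of a finite join of
    elements of M is proper and finitely generated. By quasi-compactness some
    finitely generated proper ideal contains M, hence equals M. *)

Set Implicit Arguments.
Unset Strict Implicit.
Unset Printing Implicit Defensive.

Import Order.TTheory.

Local Open Scope classical_set_scope.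

Section PrincipalIdeals.
Context {d : Order.disp_t} {Q : quantaleType d}.
Implicit Types (c x y : Q) (M : set Q).

Definition principal_ideal c : set Q := [set x | (x <= c)%O].

Lemma principal_is_ideal c : is_ideal (principal_ideal c).
Proof.
split=> [|x y xc yc|x l xc lx]; first by exists c; rewrite /principal_ideal /=.
- by rewrite /principal_ideal /= leUx xc.
- exact: le_trans lx xc.
Qed.

(** Distributing [y] over the join of [x] and the top, which is the top, makes [y] the join of
    [qmul y x] and [qmul y \top]. *)
Lemma qmul_ler (x y : Q) : (qmul x y <= y)%O.
Proof.
have lub_top : lub [set x; \top%O] = \top%O.
  by apply/eqP; rewrite -le1x; have [ub _] := lubP [set x; \top%O]; apply: ub; right.
rewrite qmulC -[leRHS]qmulx1 -lub_top qmul_lub.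
by have [ub _] := lubP (qmul y @` [set x; \top%O]); apply: ub; exists x => //; left.
Qed.

(** Every multiple of [c] lies below [c], and [c] itself is the multiple by the top. *)
Lemma gen_ideal1 c : gen_ideal [set c] = principal_ideal c.
Proof.
apply/seteqP; split=> x.
  move=> [n [a [aP xa]]]; apply: le_trans xa _; apply/joinsP => i _.
  by have [q _ [_ -> <-]] := aP i; exact: qmul_ler.
move=> xc; exists 1, (fun=> c); split; last by rewrite big_ord1.
by move=> _; exists \top%O => //; exists c => //; rewrite qmulC qmulx1.
Qed.

Lemma principal_fg_proper M c :
  is_proper_ideal M -> M c -> fg_proper_ideals Q (principal_ideal c).
Proof.
move=> [[_ _ Mdown] MT] Mc; split.
  split; first exact: principal_is_ideal.
  move=> cT; apply: MT; rewrite -subTset -cT => x; exact: Mdown Mc.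
by exists [set c]; split; [exact: finite_set1|exists c|rewrite gen_ideal1].
Qed.

Lemma ideal_joins M (s : seq Q) : is_ideal M ->
  (forall x, x \in s -> M x) -> M (\join_(x <- s) x)%O.
Proof.
move=> [[x0 Mx0] MU Mdown] sM; rewrite big_seq.
(* The empty join is the bottom, which lies below the element [x0] of [M]. *)
by apply: big_ind => //; apply: Mdown Mx0 (le0x _).
Qed.

Lemma open_setC_upset (Sigma X : set (set Q)) :
  X `<=` is_ideal -> open (~` upset Sigma X).
Proof.
move=> Xid; exists [set ~` upset Sigma X]; last by rewrite bigcup_set1.
by move=> _ ->; apply: (@finI_from1 _ _ _ (fun X => ~` upset Sigma X) X).
Qed.

(** Turns the subbasic closed set of a principal ideal into a membership condition, by downward
    closure of [J]. *)
Lemma upset_principal (Sigma : set (set Q)) x (J : quantale_space Sigma) :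
  is_ideal (set_val J) -> upset Sigma [set principal_ideal x] J <-> set_val J x.
Proof.
move=> [_ _ Jdown]; rewrite /upset /= bigcap_set1; split=> [[_]|Jx].
  by apply; exact: lexx.
split; first by exists (principal_ideal x).
by move=> y; exact: Jdown.
Qed.

End PrincipalIdeals.

Theorem proposition4p6 (d : Order.disp_t) (Q : quantaleType d) :
  cover_compact [set: quantale_space (fg_proper_ideals Q)] ->
  max_ideals Q `<=` fg_proper_ideals Q.
Proof.
move=> cpt M [Mprop Mmax].
have idJ (J : quantale_space (fg_proper_ideals Q)) : is_ideal (set_val J).
  by have [[]] := set_valP J.
suff [J MJ] : exists J : quantale_space (fg_proper_ideals Q), M `<=` set_val J.
  have [Jprop _] := set_valP J.
  suff -> : M = set_val J by exact: set_valP.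
  by apply: contrapT => /eqP neMJ; apply: (Mmax _ Jprop); rewrite properEneq.
apply: contrapT => noJ.
(* [f x] consists of the points that miss [x]; as no point contains [M], these open sets cover the
   space when [x] runs over [M]. *)
pose f (x : Q) := ~` upset (fg_proper_ideals Q) [set principal_ideal x].
have [||D DM Dcov] := cpt Q M f.
- by move=> x _; apply: open_setC_upset => _ ->; exact: principal_is_ideal.
- move=> J _; apply: contrapT => ncov; apply: noJ; exists J => x Mx.
  apply/upset_principal => //; apply: contrapT => nupJ.
  by apply: ncov; exists x.
pose c : Q := (\join_(x <- D) x)%O.
have Mc : M c by apply: ideal_joins Mprop.1 _ => x /DM; rewrite inE.
pose Jc : quantale_space (fg_proper_ideals Q) :=
  SigSub (mem_set (principal_fg_proper Mprop Mc)).
(* The point [Jc] would have to miss some [x] in [D], yet [x] lies below the join [c]. *)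
have [x /= xD] := Dcov Jc I; apply.
by apply/upset_principal => //; exact: (joins_sup_seq id xD).
Qed.
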